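(* Let $R>0$, $\beta>0$, $C_0\ge1$, $A\ge0$ and $\eta>\beta$. Let $E:(0,R]\to[0,\infty)$ be a function satisfying $$E(s)\le C_0\left(\frac sr\right)^\beta E(r)+A\,r^\eta\qquad\text{for all }0<s<r\le R.$$ Let $$1<Q\le\frac\eta\beta,$$ and choose any real number $m>0$ such that $C_0Q^{-m}<1$. Then there exists a constant $C$, depending only on $C_0,\beta,\eta,Q,m$, such that $$E(s)\le C\left(\frac{E(R)}{R^\beta}+A\,R^{\eta-\beta}\right)s^\beta\left(1+\log\frac Rs\right)^m$$ for every $0<s\le R$. *)

(* Defs.v *)
From HB Require Import structures.
From mathcomp Require Import all_boot all_order all_algebra.
From mathcomp Require Import all_classical all_reals all_analysis.

Set Implicit Arguments.
Unset Strict Implicit.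
Unset Printing Implicit Defensive.

(* Main.v *)
Require Import Defs.
From HB Require Import structures.
From mathcomp Require Import all_boot all_order all_algebra.
From mathcomp Require Import all_classical all_reals all_analysis.
From mathcomp Require Import ring lra.
Import Order.TTheory GRing.Theory Num.Theory.
Local Open Scope ring_scope.

(** Put [s = R e^(-t)] and let [F t = E s / s^beta] be the normalised energy at
    logarithmic scale [t = ln (R / s) >= 0].  Comparing the scales [u < t], the
    assumed decay reads
      [F t <= C0 F u + B e^(beta t - eta u)],  [B = A R^(eta - beta)]
    ([normalized_decay]).  The exponent is nonpositive as soon as
    [u >= t beta / eta], and [u = t / Q] is such a choice because
    [Q <= eta / beta]; hence [F t <= C0 F (t / Q) + B].  Dividing [t] by [Q]
    multiplies [t^m] by [Q^(-m)], and [C0 Q^(-m) < 1], so [D t^m] is a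
    supersolution of this recursion on [t >= 1] once
    [D (1 - C0 Q^(-m)) >= B]: an induction over the intervals [1, Q^n] bounds
    [F t] by a multiple of [t^m] for [t >= 1] ([dilation_growth]).  The induction
    starts on [1, Q], where, as for [t < 1], the comparison with [u = 0] gives
    [F t <= C0 F 0 + B e^(beta Q)].  The weight [t^m], unlike [(1 + t)^m],
    scales exactly under the dilation; the [1 +] is needed only near [t = 0]. *)

Lemma exprn_unbounded (K : realType) (Q t : K) :
  1 < Q -> exists n, t <= Q ^+ n.
Proof.
move=> Q1; have lnQ : 0 < ln Q by exact: ln_gt0.
have Qpos : Q \in Num.pos by rewrite posrE; lra.
have := @archi_boundP K (`|t| / ln Q) (divr_ge0 (normr_ge0 _) (ltW lnQ)).
set n := Num.bound _; rewrite ltr_pdivrMr// => tn.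
exists n; rewrite -(lnK Qpos) -expRM_natl.
by apply: le_trans (expR_ge1Dx _); have := ler_norm t; lra.
Qed.

(** The second summand of the constant makes [D t^m] absorb the inhomogeneity
    [B] in [F t <= c F (t / Q) + B], since [t >= 1]. *)
Lemma dilation_growth (K : realType) (c Q m B M : K) (F : K -> K) :
  0 <= c -> 1 < Q -> 0 <= m -> c * Q `^ (- m) < 1 -> 0 <= B -> 0 <= M ->
  (forall t, 1 <= t <= Q -> F t <= M) ->
  (forall t, Q < t -> F t <= c * F (t / Q) + B) ->
  forall t, 1 <= t -> F t <= (M + B / (1 - c * Q `^ (- m))) * t `^ m.
Proof.
move=> c0 Q1 m0 cQ B0 M0 base step t t1.
have Q0 : 0 < Q by lra.
set d := 1 - _; have d0 : 0 < d by rewrite /d; lra.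
set D := M + B / d.
have Bd : 0 <= B / d by rewrite divr_ge0// ltW.
have BD : B <= d * D.
  by rewrite /D mulrDr (mulrC d (B / d)) divfK ?gt_eqF// lerDr mulr_ge0// ltW.
have pow_ge1 (x : K) : 1 <= x -> 1 <= x `^ m.
  by move=> x1; have := ler_powR x1 m0; rewrite powRr0.
have start x : 1 <= x -> x <= Q -> F x <= D * x `^ m.
  move=> x1 xQ; have := base x; rewrite x1 xQ => /(_ isT) Fx.
  apply: (le_trans Fx); apply: (@le_trans _ _ D); first by rewrite /D; lra.
  by rewrite ler_peMr ?pow_ge1// /D; lra.
have [n] := exprn_unbounded K Q t Q1.
elim: n t t1 => [|n IHn] t t1 tn; have [tQ|Qt] := leP t Q.
- exact: start.
- by move: tn; rewrite expr0; lra.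
- exact: start.
have tQ1 : 1 <= t / Q by rewrite ler_pdivlMr// mul1r ltW.
have tQn : t / Q <= Q ^+ n by rewrite ler_pdivrMr// -exprSr.
have tm : (t / Q) `^ m = t `^ m * Q `^ (- m).
  rewrite powRM ?invr_ge0; [|lra|lra].
  by rewrite powRN -powR_inv1 ?ltW// -powRrM mulN1r powRN.
apply: (le_trans (step t Qt)).
have cF : c * F (t / Q) <= (1 - d) * D * t `^ m.
  have := ler_wpM2l c0 (IHn _ tQ1 tQn); rewrite tm => /le_trans; apply.
  by rewrite le_eqVlt; apply/orP; left; apply/eqP; rewrite /d; ring.
have Bt : B <= d * D * t `^ m.
  by apply: (le_trans BD); rewrite ler_peMr ?pow_ge1//; lra.
lra.
Qed.

(** Dividing the decay assumption at [s = R e^(-t)], [r = R e^(-u)] by [s^beta]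
    turns [(s / r)^beta E r] into [F u], and
    [r^eta / s^beta = R^(eta - beta) e^(beta t - eta u)]: the error no longer
    depends on [R] except through the constant factor. *)
Lemma normalized_decay (K : realType) (C0 beta eta R A : K) (E : K -> K) :
  0 < R ->
  (forall s r : K, 0 < s -> s < r -> r <= R ->
    E s <= C0 * (s / r) `^ beta * E r + A * r `^ eta) ->
  let F t := E (R * expR (- t)) / (R * expR (- t)) `^ beta in
  forall u t, 0 <= u -> u < t ->
    F t <= C0 * F u + A * R `^ (eta - beta) * expR (beta * t - eta * u).
Proof.
move=> R0 hE F u t u0 ut; rewrite /F.
have pos (x : K) : 0 < R * expR (- x) by rewrite mulr_gt0 ?expR_gt0.
set s := R * expR (- t); set r := R * expR (- u).
have s0 : 0 < s by exact: pos.
have r0 : 0 < r by exact: pos.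
have sr : s < r by rewrite /s /r ltr_pM2l// ltr_expR; lra.
have rR : r <= R by rewrite /r ger_pMr// -expR0 ler_expR; lra.
have sb0 : 0 < s `^ beta by exact: powR_gt0.
have rb0 : 0 < r `^ beta by exact: powR_gt0.
have divE : (s / r) `^ beta = s `^ beta / r `^ beta.
  rewrite powRM ?invr_ge0; [|exact: ltW|exact: ltW].
  by rewrite -powR_inv1 ?ltW// -powRrM mulN1r powRN.
have powE (x a : K) : (R * expR (- x)) `^ a = R `^ a * expR (- (a * x)).
  by rewrite powRM ?expR_ge0 1?ltW// -expRM; congr (_ * expR _); ring.
have rsE : r `^ eta =
    R `^ (eta - beta) * expR (beta * t - eta * u) * s `^ beta.
  have RE : R `^ (eta - beta) = R `^ eta / R `^ beta.
    by rewrite powRB// (gt_eqF R0) implybT.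
  rewrite /r /s !powE RE mulrACA divfK ?gt_eqF ?powR_gt0// -expRD.
  by congr (_ * expR _); ring.
have := hE s r s0 sr rR; clearbody s r.
rewrite (ler_pdivrMr _ _ sb0) => /le_trans; apply.
rewrite divE rsE le_eqVlt; apply/orP; left; apply/eqP.
by field; rewrite gt_eqF.
Qed.

(* MathComp-Analysis, over an arbitrary realType K *)
Theorem theorem6p1 (K : realType) (C0 beta eta Q m : K)
    (hC0 : 1 <= C0) (hbeta : 0 < beta) (heta : beta < eta)
    (hQ1 : 1 < Q) (hQ : Q <= eta / beta)
    (hm : 0 < m) (hC0Q : C0 * Q `^ (- m) < 1) :
  exists C : K, forall (R A : K) (E : K -> K),
    0 < R -> 0 <= A ->
    (forall s : K, 0 < s <= R -> 0 <= E s) ->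
    (forall s r : K, 0 < s -> s < r -> r <= R ->
      E s <= C0 * (s / r) `^ beta * E r + A * r `^ eta) ->
    forall s : K, 0 < s <= R ->
      E s <= C * (E R / R `^ beta + A * R `^ (eta - beta))
               * s `^ beta * (1 + ln (R / s)) `^ m.
Proof.
set d := 1 - C0 * Q `^ (- m); have d0 : 0 < d by rewrite /d; lra.
exists (C0 + expR (beta * Q) + d^-1) => R A E R0 A0 E0 hE s /andP[s0 sR].
have := normalized_decay K C0 beta eta R A E R0 hE.
set F := fun t => _; set B := A * R `^ (eta - beta) => /= decay.
have B0 : 0 <= B by rewrite mulr_ge0 ?powR_ge0.
have F0E : F 0 = E R / R `^ beta by rewrite /F oppr0 expR0 mulr1.
have F0 : 0 <= F 0 by rewrite F0E divr_ge0 ?powR_ge0// E0// R0 lexx.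
rewrite -F0E.
set t := ln (R / s).
have t0 : 0 <= t by apply: ln_ge0; rewrite ler_pdivlMr// mul1r.
have st : R * expR (- t) = s.
  rewrite expRN /t lnK ?posrE ?divr_gt0// invf_div mulrCA divff ?mulr1//.
  by rewrite gt_eqF.
have sb0 : 0 < s `^ beta by exact: powR_gt0.
have Ft : F t = E s / s `^ beta by rewrite /F st.
rewrite mulrAC -ler_pdivrMr// -Ft.
clearbody F B t; set N := F 0 + B.
have d1 : 0 < d^-1 by rewrite invr_gt0.
have eQ1 : 1 <= expR (beta * Q).
  by rewrite -expR0 ler_expR mulr_ge0; lra.
have FleN x : 0 <= x <= Q -> F x <= (C0 + expR (beta * Q)) * N.
  move=> /andP[x_ge0 xQ]; have [->|xn0] := eqVneq x 0; first by rewrite /N; nra.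
  have x_gt0 : 0 < x by rewrite lt_def xn0 x_ge0.
  have := decay 0 x (lexx 0) x_gt0; rewrite mulr0 subr0.
  have : B * expR (beta * x) <= B * expR (beta * Q).
    by rewrite ler_wpM2l// ler_expR ler_pM2l.
  have : 0 <= expR (beta * Q) * F 0 + C0 * B.
    by rewrite addr_ge0// mulr_ge0//; lra.
  by rewrite /N; lra.
have dilation x : Q < x -> F x <= C0 * F (x / Q) + B.
  move=> Qx; have Q0 : 0 < Q by lra.
  have x_gt0 : 0 < x by lra.
  have xQ0 : 0 <= x / Q by rewrite divr_ge0 ?ltW.
  have xQx : x / Q < x by rewrite ltr_pdivrMr// ltr_pMr.
  apply: (le_trans (decay _ _ xQ0 xQx)); rewrite lerD2l.
  (* The exponent [beta x - eta x / Q] is nonpositive because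
     [Q <= eta / beta]. *)
  rewrite ler_piMr// -expR0 ler_expR subr_le0 mulrCA mulrC.
  rewrite ler_pM2l// ler_pdivlMr// mulrC -ler_pdivlMr//.
have N0 : 0 <= N by rewrite addr_ge0.
have pow_le (a b : K) : 0 <= a -> a <= b -> a `^ m <= b `^ m.
  move=> a0 ab; have b0 : 0 <= b by exact: le_trans ab.
  by apply: ge0_ler_powR => //; rewrite ?nnegrE// ltW.
have C1N : 0 <= (C0 + expR (beta * Q)) * N by rewrite mulr_ge0//; lra.
have NC : 0 <= d^-1 * N by rewrite mulr_ge0// ltW.
have [t1|t1] := ltP t 1.
  apply: (@le_trans _ _ ((C0 + expR (beta * Q)) * N)).
    by apply: FleN; rewrite t0; lra.
  apply: (@le_trans _ _ ((C0 + expR (beta * Q) + d^-1) * N)); first by lra.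
  rewrite ler_peMr//; first by lra.
  have /= := pow_le 1 (1 + t) ler01; rewrite powR1; apply; lra.
have growth : F t <= ((C0 + expR (beta * Q)) * N + B / d) * t `^ m.
  apply: (dilation_growth K C0 Q m) => //; rewrite ?ltW//; [lra|].
  by move=> x /andP[x1 xQ]; apply: FleN; rewrite xQ andbT; lra.
apply: (le_trans growth); apply: ler_pM; rewrite ?powR_ge0//.
- by rewrite addr_ge0// divr_ge0// ltW.
- have : B / d <= d^-1 * N by rewrite mulrC ler_pM2l// /N; lra.
  lra.
- by apply: pow_le; lra.
Qed.
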